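(* Let $\boldsymbol\mu_l:\partial\Omega\to(\mathcal P(D),W_2)$ be a Lipschitz mapping. Then there exists a Lipschitz mapping $\boldsymbol\mu:\Omega\to(\mathcal P(D),W_2)$ such that $\boldsymbol\mu(\xi)=\boldsymbol\mu_l(\xi)$ for every $\xi\in\partial\Omega$.
   Context: $p,q\ge1$ are integers. $\Omega\subset\mathbb R^p$ is compact and connected, has non-empty interior, and has Lipschitz boundary (around any point of $\partial\Omega$, up to a rotation, $\Omega$ is the epigraph of a Lipschitz function). $D\subset\mathbb R^q$ is compact and convex with non-empty interior. $\mathcal P(D)$ is the set of Borel probability measures on $D$, endowed with the quadratic Wasserstein distance $W_2$. $\partial\Omega$ and $\Omega$ carry the Euclidean distance of $\mathbb R^p$. *)

(* Defs.v *)
From HB Require Import structures.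
From mathcomp Require Import all_boot all_order all_algebra.
From mathcomp Require Import all_classical all_reals all_analysis.
Set Implicit Arguments.
Unset Strict Implicit.
Unset Printing Implicit Defensive.
Import Order.TTheory GRing.Theory Num.Theory.
Import numFieldNormedType.Exports.
Local Open Scope classical_set_scope.
Local Open Scope ring_scope.

(* The topology of ['rV[R]_n] in the library is that of the sup norm; it is the
   Euclidean one, but the Euclidean distance itself has to be defined. *)
Definition enorm (R : realType) (n : nat) (x : 'rV[R]_n) : R :=
  Num.sqrt (\sum_(i < n) x ord0 i ^+ 2).

Definition edist (R : realType) (n : nat) (x y : 'rV[R]_n) : R := enorm (x - y).

Definition boundary (T : topologicalType) (A : set T) : set T :=
  closure A `\` interior A.

(* In the rotated coordinates [z *m Q], the last one is the vertical direction
   and [col' ord_max] keeps the others.  [Q] ranges over all orthogonal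
   matrices: reflections are harmless in dimension at least 2, and in dimension
   1, where the only matrix of determinant 1 is the identity, they are needed
   for a segment to qualify. *)
Definition lipschitz_boundary (R : realType) (n : nat) (A : set 'rV[R]_n.+1) :=
  forall x, boundary A x ->
  exists (Q : 'M[R]_n.+1) (g : 'rV[R]_n -> R) (L : R),
    [/\ Q *m Q^T = 1%:M,
        forall u v, `|g u - g v| <= L * edist u v &
        \forall z \near x, A z <->
          g (col' ord_max (z *m Q)) <= (z *m Q) ord0 ord_max].

Definition borelrV (R : realType) (n : nat) :=
  g_sigma_algebraType (@open 'rV[R]_n).

(* A Borel probability measure on a Borel set D is encoded as a Borel
   probability measure on the whole space giving mass 1 to D. *)
Definition Prob (R : realType) (n : nat) (D : set 'rV[R]_n) :=
  {mu : probability (borelrV R n) R | mu D = 1%E}.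

Definition couplings (R : realType) (n : nat) (D : set 'rV[R]_n)
    (mu nu : Prob D) : set (probability (borelrV R n * borelrV R n)%type R) :=
  [set pi | forall A : set (borelrV R n), measurable A ->
     pi (A `*` setT) = sval mu A /\ pi (setT `*` A) = sval nu A].

(* Valued in \bar R, so that no junk value occurs; it is finite for bounded D. *)
Definition W2 (R : realType) (n : nat) (D : set 'rV[R]_n) (mu nu : Prob D)
    : \bar R :=
  sqrte (ereal_inf
    [set (\int[pi]_z (edist (z.1 : 'rV[R]_n) (z.2 : 'rV[R]_n) ^+ 2)%:E)%E
       | pi in couplings mu nu]).

Definition W2_lipschitz (R : realType) (m n : nat) (A : set 'rV[R]_m)
    (D : set 'rV[R]_n) (f : 'rV[R]_m -> Prob D) :=
  exists L : R, forall x y, A x -> A y ->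
    (W2 (f x) (f y) <= (L * edist x y)%:E)%E.

(* Main.v *)
Require Import Defs.
From HB Require Import structures.
From mathcomp Require Import all_boot all_order all_algebra.
From mathcomp Require Import all_classical all_reals all_analysis measurable_realfun.
From mathcomp Require Import ring lra.
Import Order.TTheory GRing.Theory Num.Theory.
Import numFieldNormedType.Exports.
Local Open Scope classical_set_scope.
Local Open Scope ring_scope.

(** Since the boundary is locally a Lipschitz graph, near each boundary point
    the vertical projection onto the graph, cut off away from that point, is a
    Lipschitz map of [Omega] into itself fixing the boundary. Composing finitely
    many of these yields Lipschitz [r] and [t], with [t] valued in [0, 1], [t = 1]
    and [r = id] on the boundary, such that [r z] lies on the boundary as soon
    as [t z > 0]. Fix [x0] in [D] and take for [mu z] the image of [mu_l (r z)]
    under the dilation of ratio [t z] and centre [x0]. Pushing couplings forward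
    shows that this is Lipschitz; where [t z = 0] the image is the Dirac mass
    at [x0] whatever the measure, so that [r z] need not be on the boundary. *)

(** * Comparison of the sup norm with the Euclidean norm *)

Lemma coord_le_norm (R : realType) (n : nat) (x : 'rV[R]_n) (i : 'I_n) :
  `|x ord0 i| <= `|x|.
Proof.
rewrite /Num.norm/= mx_normrE.
exact: (le_bigmax_cond 0 (fun ij : 'I_1 * 'I_n => `|x ij.1 ij.2|) (j := (ord0, i))).
Qed.

Lemma norm_le_coord (R : realType) (n : nat) (x : 'rV[R]_n) (r : R) :
  0 <= r -> (forall i, `|x ord0 i| <= r) -> `|x| <= r.
Proof.
move=> r0 xr; rewrite /Num.norm/= mx_normrE; apply/bigmax_leP; split => // -[i j] _ /=.
by rewrite (ord1 i).
Qed.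

Lemma enorm_sqr (R : realType) (n : nat) (x : 'rV[R]_n) :
  enorm x ^+ 2 = \sum_(i < n) x ord0 i ^+ 2.
Proof. by rewrite sqr_sqrtr// sumr_ge0// => i _; exact: sqr_ge0. Qed.

Lemma enorm_ge0 (R : realType) (n : nat) (x : 'rV[R]_n) : 0 <= enorm x.
Proof. exact: sqrtr_ge0. Qed.

Lemma norm_le_enorm (R : realType) (n : nat) (x : 'rV[R]_n) : `|x| <= enorm x.
Proof.
apply: norm_le_coord => [|i]; first exact: enorm_ge0.
rewrite -sqrtr_sqr ler_wsqrtr// (bigD1 i)//= lerDl sumr_ge0// => j _.
exact: sqr_ge0.
Qed.

Lemma enorm_le_norm (R : realType) (n : nat) (x : 'rV[R]_n) :
  enorm x <= n%:R * `|x|.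
Proof.
rewrite -(@ler_pXn2r _ 2)// ?nnegrE ?enorm_ge0 ?mulr_ge0// enorm_sqr.
have -> : (n%:R * `|x|) ^+ 2 = (n ^ 2)%:R * `|x| ^+ 2 by rewrite exprMn natrX.
(* The sum of squares only costs a factor [n]; it is enlarged to [n ^ 2] so that no square root
   enters the constant. *)
apply: (@le_trans _ _ (n%:R * `|x| ^+ 2)).
  rewrite mulr_natl -[X in _ *+ X]card_ord -sumr_const ler_sum// => i _.
  by rewrite -[leLHS]ger0_norm ?sqr_ge0// normrX ler_pXn2r ?nnegrE// coord_le_norm.
by rewrite ler_wpM2r ?sqr_ge0// ler_nat; case: (n) => // m; rewrite leq_pmulr.
Qed.

(** * Calculus of Lipschitz maps *)

(** On row vectors this refers to the sup norm; Euclidean bounds are converted by [norm_le_enorm]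
    and [enorm_le_norm], at the price of a dimensional constant. *)
Definition lip {R : realType} {V W : normedZmodType R} (f : V -> W) :=
  exists2 C : R, 0 <= C & forall x y, `|f x - f y| <= C * `|x - y|.

Lemma lip_comp (R : realType) (U V W : normedZmodType R)
    (g : V -> W) (f : U -> V) : lip g -> lip f -> lip (g \o f).
Proof.
move=> [B B0 gB] [C C0 fC]; exists (B * C) => [|x y]; first exact: mulr_ge0.
by apply: le_trans (gB _ _) _; rewrite -mulrA ler_wpM2l.
Qed.

Lemma lip_id (R : realType) (V : normedZmodType R) : lip (@id V).
Proof. by exists 1 => // x y; rewrite mul1r. Qed.

Lemma lip_cst (R : realType) (V W : normedZmodType R) (a : W) : lip (fun _ : V => a).
Proof. by exists 0 => // x y; rewrite subrr normr0 mul0r. Qed.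

Lemma lip_norm (R : realType) (V : normedZmodType R) : lip (fun x : V => `|x|).
Proof. by exists 1 => // x y; rewrite mul1r ler_dist_dist. Qed.

Lemma lip_sub (R : realType) (V W : normedZmodType R) (f g : V -> W) :
  lip f -> lip g -> lip (fun x => f x - g x).
Proof.
move=> [B B0 fB] [C C0 gC]; exists (B + C) => [|x y]; first exact: addr_ge0.
have -> : f x - g x - (f y - g y) = (f x - f y) - (g x - g y).
  by rewrite !opprB addrACA [in RHS]addrACA; congr (_ + _); rewrite addrC.
by apply: le_trans (ler_normB _ _) _; rewrite mulrDl lerD.
Qed.

Lemma lip_scale (R : realType) (V : normedZmodType R) (W : normedModType R) (f : V -> R) (e : W) :
  lip f -> lip (fun x => f x *: e).
Proof.
move=> [B B0 fB]; exists (B * `|e|) => [|x y]; first exact: mulr_ge0.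
by rewrite -scalerBl normrZ mulrAC ler_wpM2r.
Qed.

Lemma lip_max (R : realType) (V : normedZmodType R) (f g : V -> R) :
  lip f -> lip g -> lip (fun x => Num.max (f x) (g x)).
Proof.
move=> [B B0 fB] [C C0 gC]; exists (Num.max B C) => [|x y].
  by rewrite le_max B0.
have {fB}: `|f x - f y| <= Num.max B C * `|x - y|.
  by apply: le_trans (fB _ _) _; rewrite ler_wpM2r// le_max lexx.
have {gC}: `|g x - g y| <= Num.max B C * `|x - y|.
  by apply: le_trans (gC _ _) _; rewrite ler_wpM2r// le_max lexx orbT.
rewrite !ler_norml.
by case: (leP (f x) (g x)); case: (leP (f y) (g y)); lra.
Qed.

Lemma lip_min (R : realType) (V : normedZmodType R) (f g : V -> R) :
  lip f -> lip g -> lip (fun x => Num.min (f x) (g x)).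
Proof.
move=> lf lg; have -> : (fun x => Num.min (f x) (g x)) =
    (fun x => 0 - Num.max (0 - f x) (0 - g x)).
  by apply/funext => x; case: (leP (f x)); case: (leP (0 - f x)); lra.
apply: lip_sub; first exact: lip_cst.
by apply: lip_max; apply: lip_sub => //; exact: lip_cst.
Qed.

Lemma lip_mulmx (R : realType) (m n : nat) (A : 'M[R]_(m, n)) :
  lip (fun x : 'rV[R]_m => x *m A).
Proof.
have S0 : 0 <= \sum_i \sum_j `|A i j| by rewrite !sumr_ge0// => i _; rewrite sumr_ge0.
exists (\sum_i \sum_j `|A i j|) => // x y; rewrite -mulmxBl.
apply: norm_le_coord => [|j]; first by rewrite mulr_ge0.
rewrite mxE; apply: le_trans (ler_norm_sum _ _ _) _.
rewrite mulr_suml ler_sum// => i _.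
rewrite normrM mulrC ler_pM// ?coord_le_norm//.
by rewrite (bigD1 j)//= lerDl sumr_ge0.
Qed.

Lemma lip_coord (R : realType) (n : nat) (i : 'I_n) :
  lip (fun x : 'rV[R]_n => x ord0 i).
Proof.
exists 1 => // x y; rewrite mul1r; have := coord_le_norm R n (x - y) i.
by rewrite !mxE.
Qed.

Lemma lip_col' (R : realType) (n : nat) (i : 'I_n.+1) :
  lip (fun x : 'rV[R]_n.+1 => col' i x : 'rV[R]_n).
Proof.
exists 1 => // x y; rewrite mul1r; apply: norm_le_coord => // j.
by have := coord_le_norm R n.+1 (x - y) (lift i j); rewrite !mxE.
Qed.

Lemma lip_edist (R : realType) (n : nat) (g : 'rV[R]_n -> R) (L : R) :
  (forall u v, `|g u - g v| <= L * Defs.edist u v) -> lip g.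
Proof.
move=> gL; exists (`|L| * n%:R) => [|x y]; first exact: mulr_ge0.
apply: (@le_trans _ _ (`|L| * Defs.edist x y)).
  by apply: le_trans (gL _ _) _; rewrite ler_wpM2r ?enorm_ge0// ler_norm.
by rewrite -mulrA ler_wpM2l// enorm_le_norm.
Qed.

Lemma lip_continuous (R : realType) (V W : normedModType R) (f : V -> W) :
  lip f -> continuous f.
Proof.
move=> [C C0 fC]; move=> x; apply/cvgrPdist_lt => e e0; near=> y.
apply: le_lt_trans (fC _ _) _.
apply: (@le_lt_trans _ _ ((C + 1) * `|x - y|)); first by rewrite ler_wpM2r// lerDl.
rewrite -ltr_pdivlMl ?ltr_wpDl//; near: y.
by apply: cvgr_dist_lt => //; rewrite mulr_gt0// invr_gt0 ltr_wpDl.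
Unshelve. all: by end_near. Qed.

(** * Lipschitz retractions near the boundary *)

(* [K] is the part of the boundary near which [r] has been made to retract onto
   the boundary; elsewhere [t] may vanish and [r] is then unconstrained. *)
Definition collar {R : realType} {n : nat} (Om K : set 'rV[R]_n) :=
  exists (r : 'rV[R]_n -> 'rV[R]_n) (t : 'rV[R]_n -> R),
    [/\ lip r, lip t & forall z, 0 <= t z <= 1] /\
    [/\ forall z, boundary Om z -> r z = z,
        forall z, Om z -> Om (r z),
        forall z, boundary Om z -> K z -> t z = 1 &
        forall z, Om z -> 0 < t z -> boundary Om (r z)].

Lemma collar0 (R : realType) (n : nat) (Om : set 'rV[R]_n) : collar Om set0.
Proof.
exists id, (fun=> 0); split; split => //; first exact: lip_id.
- exact: lip_cst.
- by move=> z; rewrite lexx ler01.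
- by move=> z _; rewrite ltxx.
Qed.

(** The retractions are composed: [r'] fixes what [r] has already brought to the boundary, and
    brings there the points where [t'] is positive at [r z]. Hence the maximum of [t z] and
    [t' (r z)] as weight. *)
Lemma collarU (R : realType) (n : nat) (Om K1 K2 : set 'rV[R]_n) :
  collar Om K1 -> collar Om K2 -> collar Om (K1 `|` K2).
Proof.
move=> [r [t [[lr lt t01] [rb rO tK tb]]]] [r' [t' [[lr' lt' t'01] [r'b r'O t'K t'b]]]].
exists (r' \o r), (fun z => Num.max (t z) (t' (r z))); split; split.
- exact: lip_comp.
- by apply: lip_max => //; exact: (lip_comp _ _ _ _ t' r).
- by move=> z; rewrite le_max ge_max; move: (t01 z) (t'01 (r z)) => /andP[-> ->] /andP[_ ->].
- by move=> z bz /=; rewrite rb// r'b.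
- by move=> z Oz /=; exact/r'O/rO.
- move=> z bz Kz; have /andP[_ t1] := t01 z; have /andP[_ t1'] := t'01 z.
  by rewrite rb//; case: Kz => Kz; [rewrite tK//; apply/max_idPl|rewrite t'K//; apply/max_idPr].
- move=> z Oz; rewrite lt_max => /orP[tz|tz] /=; last by apply: t'b => //; exact: rO.
  by rewrite r'b; exact: tb.
Qed.

(** Positive height is an open condition, so it gives interior points; from height 0, an arbitrarily
    small move against [e] makes the height negative and leaves [Om]. *)
Lemma boundary_graph (R : realType) (n : nat) (Om : set 'rV[R]_n)
    (h : 'rV[R]_n -> R) (e x z : 'rV[R]_n) (r : R) :
  closed Om -> continuous h -> (forall z s, h (z - s *: e) = h z - s) ->
  (forall z, ball x r z -> Om z <-> 0 <= h z) -> ball x r z ->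
  boundary Om z <-> h z = 0.
Proof.
move=> Omc hc he hO xz; split=> [[cz nz]|hz].
  have hz : 0 <= h z by apply/hO => //; exact: Omc.
  apply/eqP; rewrite eq_le hz andbT leNgt; apply/negP => hz0; apply: nz.
  have xbz : nbhs z (ball x r) by apply: open_nbhs_nbhs; split => //; exact: ball_open.
  have h0z : \forall y \near z, 0 < h y by exact: (cvgr_gt (h z) (hc z) 0 hz0).
  near=> y; apply/hO; first by near: y.
  by apply/ltW; near: y.
split.
  by apply: subset_closure; apply/hO => //; rewrite hz.
move=> Oz.
have xbz : nbhs z (ball x r) by apply: open_nbhs_nbhs; split => //; exact: ball_open.
have /nbhs_ballP[d /= d0 dO] : nbhs z (Om `&` ball x r) by exact: filterI.
have e1 : 0 < 1 + `|e| by rewrite ltr_pwDl.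
(* The shift [s *: e] is shorter than [d], so the shifted point would still be in [Om], although its
   height is [- s]. *)
pose s := d / (1 + `|e|).
have s0 : 0 < s by rewrite divr_gt0.
have [] := dO (z - s *: e).
  rewrite -ball_normE /= opprB addrC subrK normrZ gtr0_norm// /s -mulrA.
  by rewrite gtr_pMr// mulrC ltr_pdivrMr// mul1r ltrDr.
by move=> Os /hO[]/(_ Os) + _; rewrite he hz sub0r leNgt oppr_lt0 s0.
Unshelve. all: by end_near. Qed.

(** Here [h] is the height above the graph, and descending along [e] by an amount between 0 and
    [h z] keeps a point of [Om] in [Om]; descending by exactly [h z] reaches the boundary. *)
Lemma collar_graph (R : realType) (n : nat) (Om : set 'rV[R]_n)
    (h : 'rV[R]_n -> R) (e x : 'rV[R]_n) (d : R) :
  closed Om -> lip h -> (forall z s, h (z - s *: e) = h z - s) ->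
  0 < d -> (forall z, ball x d z -> Om z <-> 0 <= h z) ->
  exists2 r, 0 < r & collar Om (ball x r).
Proof.
move=> Omc hl he d0 hO.
have bd z : ball x d z -> boundary Om z <-> h z = 0.
  by apply: boundary_graph he hO => //; exact: lip_continuous.
have e1 : 0 < 1 + `|e| by rewrite ltr_pwDl.
(* A point within [r] of [x], displaced by at most [r] times the norm of [e], remains in [ball x d],
   where [Om] is described by [h]. *)
pose r := d / (1 + `|e|).
have r0 : 0 < r by rewrite divr_gt0.
have rd : r <= d by rewrite ler_pdivrMr// ler_peMr ?lerDl// ltW.
(* [z - w z *: e] falls to the graph [h = 0] when [h z + `|x - z| <= r], and [t]
   is positive only where [h z + `|x - z| < r]. *)
pose w z := Num.max 0 (Num.min (h z) (r - `|x - z|)).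
pose t z := Num.max 0 (Num.min 1 ((r - `|x - z| - Num.max 0 (h z)) *: (2 / r : R^o))).
have lxz : lip (fun z => `|x - z|).
  apply: (lip_comp _ _ _ _ (fun z => `|z|) (fun z => x - z)); first exact: lip_norm.
  by apply: lip_sub; [exact: lip_cst|exact: lip_id].
have lw : lip w.
  apply: lip_max; first exact: lip_cst.
  by apply: lip_min => //; apply: lip_sub => //; exact: lip_cst.
have lt_ : lip t.
  apply: lip_max; first exact: lip_cst.
  apply: lip_min; first exact: lip_cst.
  apply: lip_scale; apply: lip_sub; first by apply: lip_sub => //; exact: lip_cst.
  by apply: lip_max => //; exact: lip_cst.
have w_far z : r <= `|x - z| -> w z = 0.
  by move=> rz; rewrite /w; case: (leP (h z)) => ?; case: (leP 0) => ?; lra.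
have xd z : `|x - z| < r -> ball x d (z - w z *: e).
  move=> xz; rewrite -ball_normE /= opprB addrA addrAC.
  apply: le_lt_trans (ler_normD _ _) _; rewrite normrZ.
  have wr : `|w z| <= r.
    have xz0 := normr_ge0 (x - z); rewrite /w ger0_norm ?le_max ?lexx//.
    by case: (leP (h z)) => ?; case: (leP 0) => ?; lra.
  rewrite -[ltRHS](divfK (lt0r_neq0 e1)) -/r mulrDr mulr1 ltr_leD//.
  by rewrite ler_wpM2r.
have xd0 z : `|x - z| < r -> ball x d z.
  by move=> xz; rewrite -ball_normE; exact: lt_le_trans rd.
(* On the graph, the slope [2 / r] in [t] makes the truncated value reach 1 at distance [r / 2] from
   [x]. *)
exists (r / 2); first by rewrite divr_gt0.
exists (fun z => z - w z *: e), t; split; split => //.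
- by apply: lip_sub; [exact: lip_id|exact: lip_scale].
- by move=> z; rewrite /t le_max ge_max lexx ler01 ge_min lexx.
- move=> z bz; case: (leP r `|x - z|) => rz; first by rewrite w_far// scale0r subr0.
  have hz : h z = 0 by apply/bd => //; exact: xd0.
  have -> : w z = 0 by rewrite /w hz; case: (leP 0 (r - _)) => ?; [rewrite maxxx|lra].
  by rewrite scale0r subr0.
- move=> z Oz; case: (leP r `|x - z|) => rz; first by rewrite w_far// scale0r subr0.
  apply/hO; first exact: xd.
  have hz : 0 <= h z by apply/hO => //; exact: xd0.
  by rewrite he subr_ge0 /w ge_max hz ge_min lexx.
- move=> z bz; rewrite -ball_normE /= => xz.
  have hz : h z = 0 by apply/bd => //; apply: xd0; apply: lt_trans xz _; lra.
  rewrite /t hz maxxx subr0.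
  have -> : Num.min 1 ((r - `|x - z|) *: (2 / r : R^o)) = 1.
    apply/min_idPl; rewrite /GRing.scale/= mulrA ler_pdivlMr//; lra.
  by apply/max_idPr.
- move=> z Oz; have r2 : 0 < 2 / r by rewrite divr_gt0.
  rewrite /t lt_max ltxx lt_min ltr01 /= (pmulr_lgt0 _ r2) => tz.
  have h0 : 0 <= Num.max 0 (h z) by rewrite le_max lexx.
  have rz : `|x - z| < r by lra.
  have hz : 0 <= h z by apply/hO => //; exact: xd0.
  apply/bd; first exact: xd.
  move: tz; rewrite (max_idPr hz) => tz.
  rewrite he /w (min_idPl _); last by lra.
  by rewrite (max_idPr hz) subrr.
Qed.

Lemma collar_local (R : realType) (n : nat) (Om : set 'rV[R]_n.+1) (x : 'rV[R]_n.+1) :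
  closed Om -> lipschitz_boundary Om -> boundary Om x ->
  exists2 r, 0 < r & collar Om (ball x r).
Proof.
move=> Omc Ol /Ol[Q [g [L [QQ gL /nbhs_ballP[d /= d0 dO]]]]].
pose h (z : 'rV[R]_n.+1) := (z *m Q) ord0 ord_max - g (col' ord_max (z *m Q)).
(* The vertical direction in the original coordinates: multiplying by [Q] gives back the last basis
   vector, which [col' ord_max] does not see. *)
pose e : 'rV[R]_n.+1 := delta_mx ord0 ord_max *m Q^T.
apply: (collar_graph _ _ _ h e x d) => //.
- have lQ := lip_mulmx _ _ _ Q.
  apply: lip_sub; first exact: (lip_comp _ _ _ _ (fun y : 'rV[R]_n.+1 => y ord0 ord_max) _ (lip_coord _ _ _) lQ).
  apply: (lip_comp _ _ _ _ (g \o col' ord_max) _ _ lQ).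
  by apply: lip_comp; [exact: lip_edist gL|exact: lip_col'].
- move=> z s; rewrite /h mulmxBl -scalemxAl /e -mulmxA (mulmx1C QQ) mulmx1.
  have -> : col' ord_max (z *m Q - s *: delta_mx ord0 ord_max) = col' ord_max (z *m Q).
    apply/matrixP => i j; rewrite !mxE [lift _ _ == _]eq_sym.
    by rewrite (negbTE (neq_lift _ _)) andbF mulr0 subr0.
  by rewrite !mxE !eqxx mulr1 addrAC.
- by move=> z /dO ->; rewrite subr_ge0.
Qed.

Lemma collar_boundary (R : realType) (n : nat) (Om : set 'rV[R]_n.+1) :
  compact Om -> lipschitz_boundary Om -> collar Om (boundary Om).
Proof.
move=> Ok Ol.
have Oc : closed Om by apply: compact_closed => //; exact: norm_hausdorff.
have bO : boundary Om `<=` Om by move=> x [/Oc].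
apply: contrapT => nO.
(* If the boundary has no collar, the complements of the sets that have one
   generate a proper filter on it, contradicting the local collar at one of its
   cluster points. *)
pose F : set_system 'rV[R]_n.+1 :=
  [set S | exists2 K, collar Om K & boundary Om `\` K `<=` S].
have FF : ProperFilter F.
  split.
    move=> [K cK bK]; apply: nO; case: cK => r [t [? [? ? tK ?]]].
    exists r, t; split => //; split => // z bz _.
    by apply: tK => //; apply: contrapT => nK; exact: (bK z).
  split.
  - by exists set0 => //; exact: collar0.
  - move=> A B [K cK KA] [K' cK' KB]; exists (K `|` K'); first exact: collarU.
    by move=> z [bz nK]; split; [apply: KA|apply: KB]; split => // ?; apply: nK; [left|right].
  - by move=> A B AB [K cK KA]; exists K => //; exact: subset_trans AB.
have bk : compact (boundary Om).
  apply: subclosed_compact Ok bO; apply: closedI; first exact: closed_closure.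
  exact/open_closedC/open_interior.
have Fb : F (boundary Om) by exists set0; [exact: collar0|move=> z []].
have [x [bx Fx]] := bk F FF Fb.
have [d d0 cd] := collar_local _ _ _ _ Oc Ol bx.
have FB : F (boundary Om `\` ball x d) by exists (ball x d).
by have [z [[_ nz] /nz]] := Fx _ _ FB (nbhsx_ballx x d d0).
Qed.

(** * Borel measurability and image measures *)

Lemma measurable_open_borelrV (R : realType) (n : nat) (A : set 'rV[R]_n) :
  open A -> measurable (A : set (borelrV R n)).
Proof. by move=> oA; exact: sub_gen_smallest. Qed.

Lemma measurable_closed_borelrV (R : realType) (n : nat) (A : set 'rV[R]_n) :
  closed A -> measurable (A : set (borelrV R n)).
Proof.
move=> cA; rewrite -(setCK A); apply: measurableC; apply: measurable_open_borelrV.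
exact: closed_openC.
Qed.

Lemma continuous_measurable_borelrV (R : realType) (m n : nat)
    (f : 'rV[R]_m -> 'rV[R]_n) :
  continuous f -> measurable_fun setT (f : borelrV R m -> borelrV R n).
Proof.
move=> /continuousP cf; apply: (@measurability _ _ (borelrV R m) (borelrV R n) setT f (@open 'rV[R]_n)) => //.
move=> _ [B oB <-]; rewrite setTI.
by apply: measurable_open_borelrV; exact: cf.
Qed.

Lemma measurable_coord_borelrV (R : realType) (n : nat) (i : 'I_n) :
  measurable_fun setT ((fun x : 'rV[R]_n => x ord0 i) : borelrV R n -> R).
Proof.
have /continuousP ci : continuous (fun x : 'rV[R]_n => x ord0 i) by exact/lip_continuous/lip_coord.
apply: (@measurability _ _ (borelrV R n) (measurableTypeR R) setT _ (@RGenOpens.G R)); first exact: RGenOpens.measurableE.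
move=> _ [_ [a [b ->]] <-]; rewrite setTI.
apply: measurable_open_borelrV; apply: ci; exact: interval_open.
Qed.

Lemma measurable_edist (R : realType) (n : nat) :
  measurable_fun [set: borelrV R n * borelrV R n]
    (fun z => (Defs.edist (z.1 : 'rV[R]_n) (z.2 : 'rV[R]_n) ^+ 2)%:E).
Proof.
apply/measurable_EFinP.
under eq_fun do rewrite /Defs.edist enorm_sqr.
apply: measurable_sum => i; apply: measurable_funX.
under eq_fun do rewrite !mxE.
by apply: measurable_funB;
  apply: (measurableT_comp (measurable_coord_borelrV R n i)).
Qed.

(** Serves for the diagonal map, for a dilation, and for a pair of dilations acting on a
    coupling. *)
Lemma probability_pushforward d d' (T : measurableType d) (T' : measurableType d')
    (R : realType) (P : probability T R) (f : T -> T') :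
  measurable_fun setT f ->
  exists2 Q : probability T' R, forall A, Q A = P (f @^-1` A) &
    forall g : T' -> \bar R, measurable_fun setT g -> (forall y, 0 <= g y)%E ->
      (\int[Q]_y g y = \int[P]_x g (f x))%E.
Proof.
move=> mf; pose X : {mfun T >-> T'} := HB.pack f (isMeasurableFun.Build _ _ _ _ f mf).
exists (distribution P X) => // g mg g0.
by have := ge0_integral_pushforward mf P measurableT mg (fun y _ => g0 y).
Qed.

(** * Upper bounds on the Wasserstein distance *)

(** Removes the square root, so that an upper bound follows from the cost of a single coupling. *)
Lemma W2_leP (R : realType) (n : nat) (D : set 'rV[R]_n) (mu nu : Prob D) (a : R) :
  0 <= a -> (W2 mu nu <= a%:E)%E <-> (ereal_inf
    [set (\int[pi]_z (Defs.edist (z.1 : 'rV[R]_n) (z.2 : 'rV[R]_n) ^+ 2)%:E)%E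
       | pi in couplings mu nu] <= (a ^+ 2)%:E)%E.
Proof.
rewrite /W2; set I := ereal_inf _ => a0.
have : (0 <= I)%E.
  by apply/ereal_infP => _ [pi _ <-]; apply: integral_ge0 => z _; rewrite lee_fin sqr_ge0.
case: I => [r| |]//=; rewrite ?lee_fin ?leye_eq// => r0; split => h.
  by rewrite -[leLHS]sqr_sqrtr// ler_pXn2r ?nnegrE ?sqrtr_ge0.
by rewrite -[leRHS]ger0_norm// -sqrtr_sqr ler_wsqrtr.
Qed.

(** The image of [mu] under the diagonal map is a coupling of zero cost. *)
Lemma W2_refl (R : realType) (n : nat) (D : set 'rV[R]_n) (mu : Prob D) (a : R) :
  0 <= a -> (W2 mu mu <= a%:E)%E.
Proof.
move=> a0; apply/W2_leP => //.
have md : measurable_fun setT (fun x : borelrV R n => (x, x)) by exact: measurable_fun_pair.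
have [Q QA Qi] := probability_pushforward _ _ _ _ R (sval mu) _ md.
apply: ge_ereal_inf; exists (\int[Q]_z (Defs.edist (z.1 : 'rV[R]_n) (z.2 : 'rV[R]_n) ^+ 2)%:E)%E.
  exists Q => // A mA; rewrite !QA; split; congr (sval mu _);
  by apply/seteqP; split => x //= [].
rewrite Qi; first last.
- by move=> y; rewrite lee_fin sqr_ge0.
- exact: measurable_edist.
rewrite /= integral0_eq ?lee_fin ?sqr_ge0// => x _.
by rewrite /Defs.edist subrr enorm_sqr big1// => i _; rewrite mxE expr0n.
Qed.

(** * Dilations of measures and their effect on the Wasserstein distance *)

Definition dilation {R : realType} {n : nat} (x0 : 'rV[R]_n) (s : R) (x : 'rV[R]_n) :=
  x0 + s *: (x - x0).

Lemma dilation1 (R : realType) (n : nat) (x0 x : 'rV[R]_n) : dilation x0 1 x = x.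
Proof. by rewrite /dilation scale1r addrC subrK. Qed.

Lemma dilation0 (R : realType) (n : nat) (x0 x : 'rV[R]_n) : dilation x0 0 x = x0.
Proof. by rewrite /dilation scale0r addr0. Qed.

Lemma measurable_dilation (R : realType) (n : nat) (x0 : 'rV[R]_n) (s : R) :
  measurable_fun setT (dilation x0 s : borelrV R n -> borelrV R n).
Proof.
apply: continuous_measurable_borelrV; apply: lip_continuous.
exists `|s| => // x y; rewrite /dilation opprD addrACA subrr add0r.
by rewrite -scalerBr normrZ opprB addrA subrK.
Qed.

Lemma dilation_convex (R : realType) (n : nat) (D : set 'rV[R]_n) (x0 x : 'rV[R]_n) (s : R) :
  convex_set (M := 'rV[R]_n) D -> D x0 -> 0 <= s <= 1 -> D x -> D (dilation x0 s x).
Proof.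
move=> Dc D0 /andP[s0 s1] Dx.
have := Dc x x0 (Itv01 s0 s1); rewrite !inE => /(_ Dx D0).
suff -> : dilation x0 s x = conv (Itv01 s0 s1) (x : convex_lmodType 'rV[R]_n) x0 by [].
change (x0 + s *: (x - x0) = s *: x + (1 - s) *: x0).
by rewrite scalerBl scalerBr scale1r addrCA.
Qed.

(** The difference of the images is [s *: (x - y) + (s - s') *: (y - x0)]; then the square of a sum
    is at most twice the sum of the squares. *)
Lemma edist_dilation (R : realType) (n : nat) (x0 x y : 'rV[R]_n) (s s' : R) :
  0 <= s <= 1 ->
  Defs.edist (dilation x0 s x) (dilation x0 s' y) ^+ 2 <=
  2 * Defs.edist x y ^+ 2 + 2 * (s - s') ^+ 2 * Defs.edist y x0 ^+ 2.
Proof.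
move=> /andP[s0 s1]; rewrite /Defs.edist !enorm_sqr !mulr_sumr -big_split/= ler_sum// => i _.
rewrite !mxE; set a := x _ _; set b := y _ _; set c := x0 _ _.
have -> : c + s * (a - c) - (c + s' * (b - c)) = s * (a - b) + (s - s') * (b - c) by ring.
have H : (s * (a - b)) ^+ 2 <= (a - b) ^+ 2.
  by rewrite exprMn ler_piMl ?sqr_ge0// expr_le1.
rewrite -mulrA -exprMn.
move: H; set u := s * _; set v := _ * (b - c); set w := (a - b) ^+ 2 => H.
have := sqr_ge0 (u - v); rewrite sqrrB sqrrD; lra.
Qed.

(** A relation, so that one [mu] can be the image of many [nu], as happens at ratio 0. *)
Definition dilated {R : realType} {n : nat} {D : set 'rV[R]_n} (x0 : 'rV[R]_n) (s : R)
    (nu mu : Prob D) :=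
  forall A : set (borelrV R n), measurable A ->
    sval mu A = sval nu (dilation x0 s @^-1` A).

(** By convexity the dilation maps [D] into itself, so the image measure still gives [D] mass 1. *)
Lemma dilated_exists (R : realType) (n : nat) (D : set 'rV[R]_n) (x0 : 'rV[R]_n) (s : R)
    (nu : Prob D) :
  closed D -> convex_set (M := 'rV[R]_n) D -> D x0 -> 0 <= s <= 1 ->
  exists mu : Prob D, dilated x0 s nu mu.
Proof.
move=> Dcl Dc D0 s01.
have [Q QA _] := probability_pushforward _ _ _ _ R (sval nu) _ (measurable_dilation R n x0 s).
have mD : measurable (D : set (borelrV R n)) by exact: measurable_closed_borelrV.
have QD : Q D = 1%E.
  apply/eqP; rewrite eq_le probability_le1//= QA.
  apply: (@le_trans _ _ (sval nu D)); first by rewrite (svalP nu).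
  apply: le_measure; rewrite ?inE//.
    by rewrite -[_ @^-1` _]setTI; exact: measurable_dilation.
  by move=> x Dx /=; exact: dilation_convex.
by exists (exist _ Q QD) => A _.
Qed.

(** A nearly optimal coupling of [nu] and [nu'] is pushed forward by the pair of dilations, and
    [edist_dilation] is integrated. *)
Lemma W2_dilated (R : realType) (n : nat) (D : set 'rV[R]_n) (x0 : 'rV[R]_n) (M s s' a : R)
    (nu nu' mu mu' : Prob D) :
  closed D -> (forall y, D y -> Defs.edist y x0 <= M) -> 0 <= M ->
  0 <= s <= 1 -> dilated x0 s nu mu -> dilated x0 s' nu' mu' ->
  0 <= a -> (W2 nu nu' <= a%:E)%E ->
  (W2 mu mu' <= (2 * (a + M * `|s - s'|))%:E)%E.
Proof.
move=> Dcl DM M0 s01 nm nm' a0 /(W2_leP _ _ _ _ _ _ a0) H.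
have b0 : 0 <= M * `|s - s'| by rewrite mulr_ge0.
have B0 : 0 <= 2 * (a + M * `|s - s'|) by rewrite mulr_ge0// addr_ge0.
apply/W2_leP => //.
apply: (@le_trans _ _ (2 * a ^+ 2 + 2 * (M * `|s - s'|) ^+ 2)%:E); last first.
  rewrite lee_fin; move: (M * _) b0 => b b0.
  have := mulr_ge0 a0 b0; have := sqr_ge0 a; have := sqr_ge0 b.
  by rewrite exprMn sqrrD; lra.
apply/lee_addgt0Pr => e e0.
(* Half of [e], because [edist_dilation] doubles the cost of the coupling. *)
have e2 : 0 < e / 2 by rewrite divr_gt0.
have {H} : (ereal_inf
    [set (\int[pi]_z (Defs.edist (z.1 : 'rV[R]_n) (z.2 : 'rV[R]_n) ^+ 2)%:E)%E
       | pi in couplings nu nu'] < (a ^+ 2 + e / 2)%:E)%E.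
  by apply: le_lt_trans H _; rewrite lte_fin ltrDl.
move=> /ereal_inf_lt[_ [pi cpi <-] piae].
have mphi : measurable_fun setT (fun z : borelrV R n * borelrV R n =>
    (dilation x0 s z.1 : borelrV R n, dilation x0 s' z.2 : borelrV R n)).
  by apply: measurable_fun_pair; apply: measurableT_comp => //; exact: measurable_dilation.
have [Q QA Qi] := probability_pushforward _ _ _ _ R pi _ mphi.
apply: ge_ereal_inf; exists (\int[Q]_z (Defs.edist (z.1 : 'rV[R]_n) (z.2 : 'rV[R]_n) ^+ 2)%:E)%E.
  exists Q => // A mA; rewrite !QA nm// nm'//.
  have mpre u : measurable (dilation x0 u @^-1` A : set (borelrV R n)).
    by rewrite -[_ @^-1` _]setTI; exact: measurable_dilation.
  have [<- _] := cpi _ (mpre s); have [_ <-] := cpi _ (mpre s').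
  by split; congr (pi _); apply/seteqP; split => x.
rewrite Qi; first last.
- by move=> y; rewrite lee_fin sqr_ge0.
- exact: measurable_edist.
have mD : measurable (D : set (borelrV R n)) by exact: measurable_closed_borelrV.
have mE : measurable ([set: borelrV R n] `*` (D : set (borelrV R n))) by exact: measurableX.
have mdist := measurable_edist R n.
set c := (M * `|s - s'|) ^+ 2.
have c0 : 0 <= c by exact: sqr_ge0.
apply: (@le_trans _ _ (\int[pi]_z (2%:E * (Defs.edist (z.1 : 'rV[R]_n) (z.2 : 'rV[R]_n) ^+ 2)%:E
    + (2 * c)%:E))%E).
  apply: ae_ge0_le_integral => //.
  - by move=> z _; rewrite lee_fin sqr_ge0.
  - exact: (measurableT_comp mdist mphi).
  - by move=> z _; rewrite -EFinM -EFinD lee_fin addr_ge0// mulr_ge0// sqr_ge0.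
  - apply: emeasurable_funD => //; exact: measurable_funeM.
  (* The pointwise bound holds when the second point lies in [D], within [M] of [x0]; the second
     marginal [nu'] gives the complement of [D] mass 0. *)
  - exists (~` ([set: borelrV R n] `*` D)); split.
    + exact: measurableC.
    + have [_ piD] := cpi _ mD.
      by apply: etrans (probability_setC pi mE) _; rewrite piD (svalP nu') subee.
    + move=> z /= nz [_ /= Dz]; apply: nz => _.
      rewrite -EFinM -EFinD lee_fin; apply: le_trans (edist_dilation _ _ _ _ _ _ _ s01) _.
      rewrite lerD2l -mulrA ler_pM2l// /c exprMn mulrC real_normK ?num_real//.
      by rewrite ler_wpM2r ?sqr_ge0// ler_pXn2r ?nnegrE ?enorm_ge0//; exact: DM.
rewrite ge0_integralD//; first last.
- by move=> z _; rewrite lee_fin mulr_ge0.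
- exact: measurable_funeM.
- by move=> z _; rewrite -EFinM lee_fin mulr_ge0// sqr_ge0.
rewrite ge0_integralZl//; last by move=> z _; rewrite lee_fin sqr_ge0.
rewrite integral_cst// [X in (_ + _ * X)%E](probability_setT pi) mule1.
apply: (@le_trans _ _ (2%:E * (a ^+ 2 + e / 2)%:E + (2 * c)%:E)%E).
  by rewrite leeD2r// lee_pmul2l// ltW.
by rewrite -EFinM -!EFinD lee_fin; lra.
Qed.

(** * Extension of the boundary data by retraction and dilation *)

Theorem theorem4p4 (R : realType) (p q : nat)
    (Omega : set 'rV[R]_p.+1) (D : set 'rV[R]_q.+1)
    (Omega_compact : compact Omega) (Omega_connected : connected Omega)
    (Omega_int : interior Omega !=set0)
    (Omega_lip : lipschitz_boundary Omega)
    (D_compact : compact D) (D_convex : convex_set (M := 'rV[R]_q.+1) D)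
    (D_int : interior D !=set0)
    (mu_l : 'rV[R]_p.+1 -> Prob D)
    (mu_l_lip : W2_lipschitz (boundary Omega) mu_l) :
  exists mu : 'rV[R]_p.+1 -> Prob D,
    W2_lipschitz Omega mu /\
    forall xi, boundary Omega xi -> mu xi = mu_l xi.
Proof.
have [r [t [[[Cr Cr0 lr] [Ct Ct0 lt_] t01] [rb rO tb t0b]]]] :=
  collar_boundary _ _ _ Omega_compact Omega_lip.
have [x0 /interior_subset Dx0] := D_int.
have Dcl : closed D by apply: compact_closed => //; exact: norm_hausdorff.
have [M M0 DM] : exists2 M, 0 <= M & forall y, D y -> Defs.edist y x0 <= M.
  have [N [_ DN]] := compact_bounded D_compact.
  (* Boundedness holds for every number above [N], which may be negative. *)
  pose N1 := Num.max 0 (N + 1).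
  have N1P y : D y -> `|y| <= N1.
    by move=> Dy; rewrite le_max; apply/orP; right; apply: DN => //; rewrite ltrDl.
  have N10 : 0 <= N1 by rewrite le_max lexx.
  exists (q.+1%:R * (N1 + N1)) => [|y Dy]; first by rewrite mulr_ge0// addr_ge0.
  apply: le_trans (enorm_le_norm _ _ _) _; rewrite ler_wpM2l//.
  by apply: le_trans (ler_normB _ _) _; rewrite lerD// N1P.
(* The first clause selects [mu_l (r z)] itself at ratio 1: [dilated] only fixes values on Borel
   sets, whereas the boundary condition is an equality in [Prob D]. *)
have /boolp.choice[mu muP] z : exists m : Prob D,
    (t z = 1 -> m = mu_l (r z)) /\ dilated x0 (t z) (mu_l (r z)) m.
  have [tz|tz] := eqVneq (t z) 1.
    exists (mu_l (r z)); split => // A _.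
    suff -> : dilation x0 (t z) @^-1` A = A by [].
    by rewrite tz; apply/seteqP; split => x /=; rewrite dilation1.
  have [m mP] := dilated_exists _ _ _ _ _ (mu_l (r z)) Dcl D_convex Dx0 (t01 z).
  by exists m; split => // tz1; rewrite tz1 eqxx in tz.
exists mu; split; last by move=> z bz; rewrite (muP z).1 ?rb ?tb.
case: mu_l_lip => L lL.
(* At ratio 0 the preimage of [A] is everything or empty, whichever measure [nu] is taken. *)
have dil0 z nu : t z = 0 -> dilated x0 (t z) nu (mu z).
  move=> tz A mA; rewrite (muP z).2// tz.
  have [Ax|Ax] := pselect (A x0).
    have -> : dilation x0 0 @^-1` A = setT.
      by apply/seteqP; split => // x _ /=; rewrite dilation0.
    by rewrite !probability_setT.
  have -> : dilation x0 0 @^-1` A = set0.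
    by apply/seteqP; split => // x /=; rewrite dilation0.
  by rewrite !measure0.
(* [Cr] and [Ct] are the sup-norm Lipschitz constants of [r] and [t]; [p.+1] comes from measuring
   [r z - r z'] in the Euclidean norm. *)
exists (2 * (`|L| * (p.+1%:R * Cr) + M * Ct)) => z z' Oz Oz'.
have d0 : 0 <= Defs.edist z z' by exact: enorm_ge0.
(* If [t] vanishes at one of the points, the source measure of the other serves for both. Otherwise
   [r z] and [r z'] lie on the boundary, where [mu_l] is Lipschitz. *)
have [nu [nu' [nz nz' Wn]]] : exists nu nu', [/\ dilated x0 (t z) nu (mu z),
    dilated x0 (t z') nu' (mu z') &
    (W2 nu nu' <= (`|L| * (p.+1%:R * Cr) * Defs.edist z z')%:E)%E].
  have a0 : 0 <= `|L| * (p.+1%:R * Cr) * Defs.edist z z' by rewrite !mulr_ge0.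
  have [tz|tz] := eqVneq (t z) 0.
    by exists (mu_l (r z')), (mu_l (r z')); split; [exact: dil0|exact: (muP z').2|exact: W2_refl].
  have [tz'|tz'] := eqVneq (t z') 0.
    by exists (mu_l (r z)), (mu_l (r z)); split; [exact: (muP z).2|exact: dil0|exact: W2_refl].
  exists (mu_l (r z)), (mu_l (r z')); split; [exact: (muP z).2|exact: (muP z').2|].
  have tp y : t y != 0 -> 0 < t y by have /andP[] := t01 y; rewrite lt_neqAle eq_sym => -> _ ->.
  apply: le_trans (lL _ _ (t0b _ Oz (tp _ tz)) (t0b _ Oz' (tp _ tz'))) _.
  rewrite lee_fin; apply: (@le_trans _ _ (`|L| * Defs.edist (r z) (r z'))).
    by rewrite ler_wpM2r ?enorm_ge0// ler_norm.
  rewrite -!mulrA ler_wpM2l//; apply: le_trans (enorm_le_norm _ _ _) _.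
  rewrite ler_wpM2l//; apply: le_trans (lr _ _) _.
  by rewrite ler_wpM2l// norm_le_enorm.
have a0 : 0 <= `|L| * (p.+1%:R * Cr) * Defs.edist z z' by rewrite !mulr_ge0.
apply: le_trans (W2_dilated _ _ _ _ _ _ _ _ _ _ _ _ Dcl DM M0 (t01 z) nz nz' a0 Wn) _.
rewrite lee_fin -[leRHS]mulrA ler_pM2l// mulrDl lerD2l -[leRHS]mulrA ler_wpM2l//.
by apply: le_trans (lt_ _ _) _; rewrite ler_wpM2l// norm_le_enorm.
Qed.
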